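(* For all positive integers $r,n$, the following identity holds in $\mathbb{Z}[[z_0,\ldots,z_n]]$: \[ \sum_{ k \ge 0 } \prod_{ j=1 }^n [k+1]_{ z_j } \, z_0^k \ = \ \sum_{\pi\in S_n} \sum_{(\rho,\epsilon)\in I_{r,n}} \frac{\displaystyle \prod_{j\in \mathrm{Des}(\pi)} z_0z_{\pi(1)}z_{\pi(2)}\cdots z_{\pi(j)} \prod_{j\in \mathrm{NNeg}((\rho,\epsilon)^{-1})} z_0z_{\pi(1)}z_{\pi(2)}\cdots z_{\pi(j)} }{\displaystyle (1-z_0)\prod_{j=1}^n \left(1-z_0^r z_{\pi(1)}^r\cdots z_{\pi(j)}^r \right) } \, , \] where the second product in the numerator runs over the multiset $\mathrm{NNeg}((\rho,\epsilon)^{-1})$ with multiplicity (each $j$ contributing as many factors as its multiplicity).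
   Context: $[m]_z=1+z+\cdots+z^{m-1}$. For $\pi\in S_n$, $\mathrm{Des}(\pi)=\{j\in[n-1]:\pi(j)>\pi(j+1)\}$. Let $\omega=e^{2\pi i/r}$. The wreath product $\mathbb{Z}_r\wr S_n$ consists of pairs $(\pi,\epsilon)$ with $\pi\in S_n$, $\epsilon_j=\omega^{c_j}$, $c_j\in\{0,\ldots,r-1\}$ (colors). Identify $(\pi,\epsilon)$ with the $n\times n$ matrix with entry $\epsilon_i$ in position $(\pi(i),i)$ and zeros elsewhere; group operation and inverses are matrix multiplication and matrix inverse. Window notation: $[\pi(1)^{c_1}\cdots\pi(n)^{c_n}]$. Totally order pairs $j^{c}$ by $j^{c}<k^{d}$ if $c>d$, or $c=d$ and $j<k$. $\mathrm{Des}_A(\pi,\epsilon)=\{i\in[n-1]:\pi(i)^{c_i}>\pi(i+1)^{c_{i+1}}\}$, and $I_{r,n}$ is the set of elements with $\mathrm{Des}_A=\emptyset$. For $(\sigma,\delta)$ with colors $d_i$, $\mathrm{NNeg}(\sigma,\delta)$ is the multiset containing each $i\in[n]$ with multiplicity $d_i$; equivalently, $\mathrm{NNeg}((\rho,\epsilon)^{-1})$ contains $\rho(i)$ with multiplicity $(r-c_i)\bmod r$. *)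

(* Defs.v *)
From HB Require Import structures.
From mathcomp Require Import all_boot all_order all_algebra all_fingroup.
From mathcomp Require Import boolp mpoly.

Set Implicit Arguments.
Unset Strict Implicit.
Unset Printing Implicit Defensive.

Import GRing.Theory.

Local Open Scope ring_scope.

(* Formal power series in n variables over R, as families of coefficients
   indexed by the exponent vectors 'X_{1..n}.  The product is the Cauchy
   product; a series is a unit iff its constant coefficient is.               *)
Record mfps (n : nat) (R : Type) := MFps { mfcoef : 'X_{1.. n} -> R }.

HB.instance Definition _ (n : nat) (R : Type) := gen_eqMixin (mfps n R).
HB.instance Definition _ (n : nat) (R : Type) := gen_choiceMixin (mfps n R).

Lemma mfpsP (n : nat) (R : Type) (f g : mfps n R) : mfcoef f =1 mfcoef g <-> f = g.
Proof. by split=> [|-> //]; case: f g => [f] [g] /= /funext ->. Qed.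

Section Zmod.
Variables (n : nat) (R : zmodType).
Implicit Types f g : mfps n R.

Definition mfzero : mfps n R := MFps (fun=> 0).
Definition mfopp f := MFps (fun m => - mfcoef f m).
Definition mfadd f g := MFps (fun m => mfcoef f m + mfcoef g m).

Fact mfaddA : associative mfadd.
Proof. by move=> f g h; apply/mfpsP => m /=; rewrite addrA. Qed.
Fact mfaddC : commutative mfadd.
Proof. by move=> f g; apply/mfpsP => m /=; rewrite addrC. Qed.
Fact mfadd0 : left_id mfzero mfadd.
Proof. by move=> f; apply/mfpsP => m /=; rewrite add0r. Qed.
Fact mfaddN : left_inverse mfzero mfopp mfadd.
Proof. by move=> f; apply/mfpsP => m /=; rewrite addNr. Qed.

HB.instance Definition _ :=
  GRing.isZmodule.Build (mfps n R) mfaddA mfaddC mfadd0 mfaddN.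

Lemma mfcoef0 m : mfcoef (0 : mfps n R) m = 0. Proof. by []. Qed.
Lemma mfcoefN f m : mfcoef (- f) m = - mfcoef f m. Proof. by []. Qed.
Lemma mfcoefD f g m : mfcoef (f + g) m = mfcoef f m + mfcoef g m.
Proof. by []. Qed.
Lemma mfcoefB f g m : mfcoef (f - g) m = mfcoef f m - mfcoef g m.
Proof. by []. Qed.
Lemma mfcoef_sum (I : Type) (r : seq I) (P : pred I) (F : I -> mfps n R) m :
  mfcoef (\sum_(i <- r | P i) F i) m = \sum_(i <- r | P i) mfcoef (F i) m.
Proof. by elim/big_rec2: _ => // i x y _ <-. Qed.

End Zmod.

Section ComRing.
Variables (n : nat) (R : comNzRingType).
Implicit Types f g h : mfps n R.

Definition mfconst (c : R) : mfps n R := MFps (fun m => c *+ (m == 0%MM)).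
Definition mfvar (i : 'I_n) : mfps n R := MFps (fun m => (m == U_(i)%MM)%:R).

Definition mfmul f g : mfps n R :=
  MFps (fun m =>
    \sum_(k : 'X_{1..n < (mdeg m).+1, (mdeg m).+1} | m == (k.1 + k.2)%MM)
      mfcoef f k.1 * mfcoef g k.2).

Definition mftrunc (d : nat) f : {mpoly R[n]} :=
  \sum_(m : 'X_{1..n < d}) mfcoef f m *: 'X_[m].

Lemma mftruncE d f m : (mdeg m < d)%N -> (mftrunc d f)@_m = mfcoef f m.
Proof. exact: mcoeff_mpoly. Qed.

Lemma eq_mcoeffM (p p' q q' : {mpoly R[n]}) m :
  (forall k, (mdeg k <= mdeg m)%N -> p@_k = p'@_k) ->
  (forall k, (mdeg k <= mdeg m)%N -> q@_k = q'@_k) ->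
  (p * q)@_m = (p' * q')@_m.
Proof.
move=> Ep Eq; rewrite !mcoeffM; apply: eq_bigr => -[k1 k2] _ /=.
by rewrite Ep ?Eq // -ltnS bmdeg.
Qed.

Lemma mfcoef_mul d f g m : (mdeg m < d)%N ->
  mfcoef (mfmul f g) m = (mftrunc d f * mftrunc d g)@_m.
Proof.
move=> lt_md; rewrite mcoeffM /=; apply: eq_bigr => -[k1 k2] _ /=.
by rewrite !mftruncE // (leq_trans (bmdeg _)).
Qed.

Lemma mftrunc_mul d f g m : (mdeg m < d)%N ->
  (mftrunc d (mfmul f g))@_m = (mftrunc d f * mftrunc d g)@_m.
Proof. by move=> lt_md; rewrite mftruncE // (mfcoef_mul _ _ lt_md). Qed.

Fact mfmulA : associative mfmul.
Proof.
move=> f g h; apply/mfpsP => m; rewrite !(mfcoef_mul _ _ (ltnSn (mdeg m))).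
transitivity ((mftrunc (mdeg m).+1 f *
               (mftrunc (mdeg m).+1 g * mftrunc (mdeg m).+1 h))@_m).
  by apply: eq_mcoeffM => // k le_km; rewrite mftrunc_mul.
by rewrite mulrA; apply: eq_mcoeffM => // k le_km; rewrite mftrunc_mul.
Qed.

Fact mfmulC : commutative mfmul.
Proof.
by move=> f g; apply/mfpsP => m; rewrite !(mfcoef_mul _ _ (ltnSn (mdeg m))) mulrC.
Qed.

Fact mfmul1 : left_id (mfconst 1) mfmul.
Proof.
move=> f; apply/mfpsP => m; rewrite (mfcoef_mul _ _ (ltnSn (mdeg m))).
rewrite -[RHS](mftruncE _ (ltnSn (mdeg m))) -[in RHS](mul1r (mftrunc _ f)).
by apply: eq_mcoeffM => // k le_km; rewrite mftruncE // mcoeff1.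
Qed.

Fact mfmulDl : left_distributive mfmul +%R.
Proof.
move=> f g h; apply/mfpsP => m /=; rewrite -big_split /=.
by apply: eq_bigr => k _; rewrite mulrDl.
Qed.

Fact mfone_neq0 : mfconst 1 != 0.
Proof.
by apply/eqP => /mfpsP /(_ 0%MM) /=; rewrite eqxx => /eqP; rewrite oner_eq0.
Qed.

HB.instance Definition _ := GRing.Zmodule_isComNzRing.Build (mfps n R)
  mfmulA mfmulC mfmul1 mfmulDl mfone_neq0.

Lemma mfcoef1 m : mfcoef (1 : mfps n R) m = (m == 0%MM)%:R.
Proof. by []. Qed.

Lemma mfcoefM f g m :
  mfcoef (f * g) m =
  \sum_(k : 'X_{1..n < (mdeg m).+1, (mdeg m).+1} | m == (k.1 + k.2)%MM)
    mfcoef f k.1 * mfcoef g k.2.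
Proof. by []. Qed.

Lemma mfcoefM0 f g : mfcoef (f * g) 0%MM = mfcoef f 0%MM * mfcoef g 0%MM.
Proof.
have z (k : 'X_{1..n < (mdeg (0%MM : 'X_{1..n})).+1}) : k = 0%MM :> 'X_{1..n}.
  by apply/eqP; rewrite -mdeg_eq0 -leqn0 -[leqRHS](@mdeg0 n) -ltnS bmdeg.
rewrite mfcoefM (bigD1 (bm0, bm0)) /= ?addm0 // big1 ?addr0 // => -[k1 k2] /=.
case/andP=> _ /eqP []; congr (_, _); apply: val_inj; exact: z.
Qed.

Lemma mfcoefCM c f m : mfcoef (mfconst c * f) m = c * mfcoef f m.
Proof.
rewrite [LHS](mfcoef_mul _ _ (ltnSn (mdeg m))).
have -> : mftrunc (mdeg m).+1 (mfconst c) = c%:MP.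
  apply/mpolyP => k; rewrite mcoeffC.
  have [lt_k|ge_k] := ltnP (mdeg k) (mdeg m).+1.
    by rewrite mftruncE //= mulr_natr.
  rewrite -mdeg_eq0 (gtn_eqF (leq_trans _ ge_k)) // mulr0.
  rewrite raddf_sum big1 // => -[i lt_i] _ /=.
  rewrite mcoeffZ mcoeffX; case: (i =P k) => [E|]; rewrite ?mulr0 //.
  by move: ge_k; rewrite -E leqNgt lt_i.
by rewrite mcoeffCM mftruncE.
Qed.

Lemma mfcoefX_eq0 f k m :
  mfcoef f 0%MM = 0 -> (mdeg m < k)%N -> mfcoef (f ^+ k) m = 0.
Proof.
move=> f0; elim: k m => // k IHk m lt_mk; rewrite exprS mfcoefM big1 //.
case=> k1 k2 /= /eqP E; have [->|nz] := eqVneq (k1 : 'X_{1.. n}) 0%MM.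
  by rewrite f0 mul0r.
have lt_k2m : (mdeg k2 < mdeg m)%N.
  rewrite [X in (_ < mdeg X)%N](_ : _ = (k1 + k2)%MM) // mdegD -add1n leq_add2r.
  by rewrite lt0n mdeg_eq0.
by rewrite IHk ?mulr0 // (leq_trans lt_k2m).
Qed.

End ComRing.

Arguments mfvar {n R} i.

Section ComUnitRing.
Variables (n : nat) (R : comUnitRingType).
Implicit Types f g : mfps n R.

Definition mfunit : {pred mfps n R} :=
  fun f => mfcoef f 0%MM \is a GRing.unit.

(* With u the constant coefficient of f and h = 1 - f / u, the inverse of f is
   (\sum_k h ^+ k) / u, and h ^+ k has no term of degree less than k.         *)
Definition mfinv f : mfps n R :=
  if f \in mfunit then
    let c := (mfcoef f 0%MM)^-1 in
    MFps (fun m => mfcoef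
      (mfconst n c * \sum_(k < (mdeg m).+1) (1 - mfconst n c * f) ^+ k) m)
  else f.

Fact mfmulV : {in mfunit, left_inverse 1 mfinv *%R}.
Proof.
move=> f Uf; rewrite /mfinv Uf; set c := _^-1; set h := 1 - _.
have h0 : mfcoef h 0%MM = 0.
  by rewrite mfcoefB mfcoef1 eqxx mfcoefCM mulVr ?subrr.
have Ecf : mfconst n c * f = 1 - h by rewrite opprB addrC subrK.
apply/mfpsP => m.
have Ek (k : 'X_{1.. n}) : (mdeg k <= mdeg m)%N ->
    mfcoef (mfconst n c * \sum_(i < (mdeg k).+1) h ^+ i) k =
    mfcoef (mfconst n c * \sum_(i < (mdeg m).+1) h ^+ i) k.
  move=> le_km; rewrite !mfcoefCM; congr (_ * _); rewrite !mfcoef_sum.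
  rewrite -!(big_mkord xpredT (fun i => mfcoef (h ^+ i) k)).
  rewrite [RHS](@big_cat_nat _ _ _ (mdeg k).+1) //=.
  rewrite -[LHS]addr0; congr (_ + _); rewrite big_nat_cond big1 //.
  by move=> i /andP[/andP[lt_i _] _]; apply: mfcoefX_eq0.
transitivity (mfcoef ((mfconst n c * \sum_(k < (mdeg m).+1) h ^+ k) * f) m).
  rewrite !mfcoefM; apply: eq_bigr => -[k1 k2] _; congr (_ * _).
  by apply: Ek; rewrite -ltnS bmdeg.
rewrite mulrAC Ecf -opprB mulNr -subrX1 opprB mfcoefB.
by rewrite (mfcoefX_eq0 h0) // subr0.
Qed.

Fact mfunitPl f g : g * f = 1 -> mfunit f.
Proof.
move=> E; apply/unitrPr; exists (mfcoef g 0%MM).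
by rewrite mulrC -mfcoefM0 E mfcoef1 eqxx.
Qed.

Fact mfinv_out : {in [predC mfunit], mfinv =1 id}.
Proof. by move=> f /negbTE Uf; rewrite /mfinv Uf. Qed.

HB.instance Definition _ := GRing.ComNzRing_hasMulInverse.Build (mfps n R)
  mfmulV mfunitPl mfinv_out.

Lemma mfunitE f : (f \is a GRing.unit) = (mfcoef f 0%MM \is a GRing.unit).
Proof. by []. Qed.

End ComUnitRing.

(* S is the sum of the series of the F k, in the formal topology: every
   coefficient of the partial sums is eventually equal to that of S.          *)
Definition mfsums (n : nat) (R : zmodType) (F : nat -> mfps n R)
    (S : mfps n R) : Prop :=
  forall m, exists N, forall K, (N <= K)%N ->
    mfcoef (\sum_(k < K) F k) m = mfcoef S m.

Definition qnum (R : nzRingType) (m : nat) (z : R) : R := \sum_(i < m) z ^+ i.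

(* Throughout, j in [n] is represented by the ordinal j - 1 : 'I_n.           *)

Definition Des (n : nat) (p : 'S_n) : {set 'I_n} :=
  [set j : 'I_n | [exists k : 'I_n, (k == j.+1 :> nat) && (p k < p j)%N]].

(* The pair (p, c) stands for (p, eps) with eps_j = omega ^ c_j.              *)
Definition wreath (r n : nat) : finType := ('S_n * {ffun 'I_n -> 'I_r})%type.

Definition wmx (r n : nat) (F : nzRingType) (omega : F) (x : wreath r n) :
    'M[F]_n :=
  \matrix_(i, j) (if i == x.1 j then omega ^+ x.2 j else 0).

Definition opp_color (r : nat) (c : 'I_r) : 'I_r :=
  Ordinal (ltn_pmod (r - c) (leq_ltn_trans (leq0n c) (ltn_ord c))).

(* The inverse in the wreath product; see winv_mx.                            *)
Definition winv (r n : nat) (x : wreath r n) : wreath r n :=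
  ((x.1^-1)%g, [ffun k => opp_color (x.2 ((x.1^-1)%g k))]).

Lemma winv_mx (r n : nat) (F : comUnitRingType) (omega : F) (x : wreath r n) :
  omega ^+ r = 1 ->
  wmx omega x \in unitmx /\ wmx omega (winv x) = invmx (wmx omega x).
Proof.
move=> w1; have E : wmx omega (winv x) *m wmx omega x = 1%:M.
  apply/matrixP => i j; rewrite !mxE (bigD1 (x.1 j)) //= big1 => [|k ne].
    rewrite !mxE eqxx /= permK addr0 ffunE permK /=.
    case: eqP => [_|]; rewrite ?mul0r // -exprD.
    rewrite -(expr_mod _ w1) modnDml subnK 1?ltnW //.
    by rewrite modnn.
  by rewrite !mxE (negbTE ne) mulr0.
have [_ Ux] := mulmx1_unit E; split=> //.
by rewrite -[LHS]mulmx1 -(mulmxV Ux) mulmxA E mul1mx.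
Qed.

Definition clt (r n : nat) (a b : 'I_n * 'I_r) : bool :=
  (b.2 < a.2)%N || (a.2 == b.2) && (a.1 < b.1)%N.

Definition DesA (r n : nat) (x : wreath r n) : {set 'I_n} :=
  [set i : 'I_n | [exists k : 'I_n, (k == i.+1 :> nat) &&
                     clt (x.1 k, x.2 k) (x.1 i, x.2 i)]].

Definition Irn (r n : nat) : {set wreath r n} := [set x | DesA x == set0].

(* The multiset NNeg, given by its multiplicity function.                     *)
Definition NNeg (r n : nat) (x : wreath r n) (i : 'I_n) : nat := x.2 i.

Lemma NNeg_winv (r n : nat) (x : wreath r n) (i : 'I_n) :
  NNeg (winv x) (x.1 i) = ((r - x.2 i) %% r)%N.
Proof. by rewrite /NNeg /= ffunE permK. Qed.

Definition z0 (n : nat) : mfps n.+1 int := mfvar ord0.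
Definition zv (n : nat) (j : 'I_n) : mfps n.+1 int := mfvar (lift ord0 j).

(* z_0 z_{p(1)} ... z_{p(j)} *)
Definition zpre (n : nat) (p : 'S_n) (j : 'I_n) : mfps n.+1 int :=
  z0 n * \prod_(i < n | (i <= j)%N) zv (p i).

Lemma unit_den (r n : nat) (p : 'S_n) : (0 < r)%N ->
  (1 - z0 n) *
  \prod_(j < n) (1 - z0 n ^+ r * \prod_(i < n | (i <= j)%N) zv (p i) ^+ r)
    \is a GRing.unit.
Proof.
move=> r_gt0; have z0E : mfcoef (z0 n) 0%MM = 0.
  by rewrite /= eq_sym -mdeg_eq0 mdeg1.
rewrite unitrM mfunitE mfcoefB mfcoef1 eqxx z0E subr0 unitr1 /=.
apply: (big_ind (fun f : mfps n.+1 int => f \is a GRing.unit)); rewrite ?unitr1 //.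
  by move=> f g Uf Ug; rewrite unitrM Uf.
move=> j _; rewrite mfunitE mfcoefB mfcoef1 eqxx mfcoefM0.
by rewrite (mfcoefX_eq0 z0E) ?mdeg0 // mul0r subr0 unitr1.
Qed.

(* Main.v *)
Require Import Defs.
From mathcomp Require Import all_boot all_order all_algebra all_fingroup.
From mathcomp Require Import mpoly zify.

(* Both sides are the indicator series of the exponents m with m_j <= m_0 for all
   j; on the left this is clear.  On the right, write y_j = z_0 z_{p(1)} ... z_{p(j)}.
   An element of I_{r,n} is determined by the colors of the values 1, ..., n, so the
   inner sum of the products over NNeg is \prod_j [r]_{y_j}, which cancels against
   the denominator and leaves \prod_{j in Des p} y_j / ((1 - z_0) \prod_j (1 - y_j)).
   This is the indicator series of the m such that m_0 >= m_{p(1)} >= ... >= m_{p(n)},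
   with a strict inequality at each descent of p; each m with all m_j <= m_0 satisfies
   this for exactly one p, the stable sort of its entries in decreasing order. *)

Set Implicit Arguments.
Unset Strict Implicit.
Unset Printing Implicit Defensive.

Import GRing.Theory.

Local Open Scope ring_scope.

(** * Monomials as power series *)

Section Monomials.
Variables (n : nat) (R : comNzRingType).
Implicit Types (u m : 'X_{1..n}) (f : mfps n R).

Definition mfX u : mfps n R := MFps (fun m => (m == u)%:R).

(** Only the pair [(u, m - u)] contributes to the Cauchy product. *)
Lemma mfcoefXM u f m :
  mfcoef (mfX u * f) m = if (u <= m)%MM then mfcoef f (m - u)%MM else 0.
Proof.
rewrite mfcoefM; case: ifP => [le_um|nle_um]; last first.
  rewrite big1 // => -[k1 k2] /= /eqP E.
  case: eqP => [E1|_]; rewrite ?mul0r //.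
  by move: nle_um; rewrite [X in (_ <= X)%MM]E E1 lem_addr.
have lt1 : (mdeg u < (mdeg m).+1)%N.
  by rewrite ltnS -(submK le_um) mdegD leq_addl.
have lt2 : (mdeg (m - u)%MM < (mdeg m).+1)%N.
  by rewrite ltnS -[X in (_ <= mdeg X)%N](submK le_um) mdegD leq_addr.
rewrite (bigD1 (BMultinom lt1, BMultinom lt2)) /=; last by rewrite addmC submK.
rewrite eqxx mul1r big1 ?addr0 // => -[k1 k2] /= /andP[/eqP E ne].
case: eqP => [E1|_]; rewrite ?mul0r //.
case/eqP: ne; congr (_, _); apply: val_inj => //=.
by rewrite [X in (X - u)%MM]E E1 addmC addmK.
Qed.

Lemma mfXD u v : mfX (u + v)%MM = mfX u * mfX v.
Proof.
apply/mfpsP => m; rewrite mfcoefXM /=; case: ifP => [le_um|nle_um].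
  congr (nat_of_bool _)%:R; apply/eqP/eqP => [->|<-].
    by rewrite addmC addmK.
  by rewrite addmC submK.
case: eqP => // E; by rewrite E lem_addr in nle_um.
Qed.

Lemma mfX0 : mfX 0%MM = 1. Proof. by []. Qed.

Lemma mfX_sum (I : Type) (s : seq I) (P : pred I) (F : I -> 'X_{1..n}) :
  mfX (\sum_(i <- s | P i) F i)%MM = \prod_(i <- s | P i) mfX (F i).
Proof. exact: (big_morph mfX mfXD mfX0). Qed.

Lemma mfXMn u k : mfX (u *+ k)%MM = mfX u ^+ k.
Proof.
by elim: k => [|k IHk]; rewrite ?mulm0n // mulmS mfXD IHk exprS.
Qed.

End Monomials.

(** * Generating series of decreasing exponent sequences *)

Section Chains.
Variables (N : nat) (R : comNzRingType) (q : 'S_N) (d : nat -> nat).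
Implicit Type m : 'X_{1..N}.

(* The exponent of the variable in position i; position N holds 0. *)
Definition mpos m (i : nat) : nat :=
  if insub i is Some j then m (q j) else 0%N.

(* The slacks mpos m i - mpos m i.+1 are at least d i, and equal to d i for i < k.
   Multiplying by X^(mpre k) raises only the slack at k, so that multiplying the
   indicator series of chain k by 1 - X^(mpre k) gives that of chain k.+1. *)
Definition chain (k : nat) m : bool :=
  [forall i : 'I_N, (mpos m i.+1 + d i <= mpos m i)%N &&
     ((i < k)%N ==> (mpos m i == mpos m i.+1 + d i)%N)].

Definition mpre (k : nat) : 'X_{1..N} :=
  (\sum_(i < N | (i <= k)%N) U_(q i))%MM.

Lemma mposE m (i : 'I_N) : mpos m i = m (q i).
Proof. by rewrite /mpos valK. Qed.

Lemma mpos_default m i : (N <= i)%N -> mpos m i = 0%N.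
Proof. by move=> le; rewrite /mpos insubF // ltnNge le. Qed.

Lemma mpreE k (i : 'I_N) : mpre k (q i) = (i <= k)%N.
Proof.
rewrite mnm_sumE; have [le|lt] := leqP i k.
  rewrite (bigD1 i) //= mnm1E eqxx big1 // => j /andP[_ ne].
  by rewrite mnm1E (inj_eq perm_inj) (negbTE ne).
rewrite big1 // => j le; rewrite mnm1E (inj_eq perm_inj).
by case: eqP => // E; move: le; rewrite E leqNgt lt.
Qed.

Lemma lep_mpre k m :
  reflect (forall i, (i < N)%N -> (i <= k)%N -> (0 < mpos m i)%N) (mpre k <= m)%MM.
Proof.
apply: (iffP mnm_lepP) => [H i ltiN leik | H j].
  have := H (q (Ordinal ltiN)); rewrite mpreE /= leik.
  by rewrite -(mposE m (Ordinal ltiN)).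
have -> : j = q ((q^-1)%g j) by rewrite permKV.
rewrite mpreE -mposE; case: (leqP _ k) => // le; exact: H.
Qed.

Lemma mposB k m i : (k < N)%N ->
  mpos (m - mpre k)%MM i = (mpos m i - (i <= k))%N.
Proof.
move=> ltkN; have [lt|le] := ltnP i N.
  by rewrite -[i]/(val (Ordinal lt)) !mposE mnmBE mpreE.
by rewrite !mpos_default.
Qed.

Lemma chainP k m :
  reflect (forall i, (i < N)%N -> (mpos m i.+1 + d i <= mpos m i)%N /\
     ((i < k)%N -> mpos m i = (mpos m i.+1 + d i)%N)) (chain k m).
Proof.
apply: (iffP forallP) => [H i lt | H i].
  have /andP[-> /implyP H2] := H (Ordinal lt); split => // /H2 /eqP //.
have [-> H2] := H i (ltn_ord i); by apply/implyP => /H2 /eqP.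
Qed.

Lemma chain_mono k m i j : chain k m -> (i <= j)%N -> (mpos m j <= mpos m i)%N.
Proof.
move=> /chainP H; apply: (homo_leq (r := fun a b => (b <= a)%N)) => //.
  by move=> b a c le1 le2; apply: leq_trans le2 le1.
move=> {j} j; have [lt|le] := ltnP j N; last by rewrite mpos_default // leqW.
by have [le _] := H j lt; apply: leq_trans le; rewrite leq_addr.
Qed.

(** Subtracting [mpre k] lowers positions 0, ..., k by one, so only the slack at [k] drops; it has
    to exceed [d k] beforehand to stay admissible. *)
Lemma chainB k m : (k < N)%N -> (mpre k <= m)%MM ->
  chain k (m - mpre k)%MM = chain k m && (mpos m k != mpos m k.+1 + d k)%N.
Proof.
move=> ltkN /lep_mpre ge1; apply/idP/andP => [/chainP H | [/chainP H ne]].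
  split; last first.
    by have [] := H k ltkN; have := ge1 k ltkN (leqnn k); rewrite !mposB //; lia.
  apply/chainP => i lt; have [] := H i lt; have := ge1 i lt; rewrite !mposB //.
  by have [ltik|ltki|E] := ltngtP i k; [have := ge1 i.+1; lia | lia | subst; lia].
apply/chainP => i lt; have [] := H i lt; have := ge1 i lt; rewrite !mposB //.
by have [ltik|ltki|E] := ltngtP i k; [have := ge1 i.+1; lia | lia | subst; lia].
Qed.

Lemma chainS k m : (k < N)%N ->
  chain k.+1 m = chain k m && (mpos m k == mpos m k.+1 + d k)%N.
Proof.
move=> ltkN; apply/chainP/andP => [H | [/chainP H /eqP Ek] i lt].
  split; last by have [_ /(_ (ltnSn k)) ->] := H k ltkN.
  by apply/chainP => i lt; have [? E] := H i lt; split=> // /ltnW/E.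
have [le E] := H i lt; split=> //; rewrite ltnS leq_eqVlt => /orP[/eqP ->|] //.
Qed.

Definition chain_series (k : nat) : mfps N R := MFps (fun m => (chain k m)%:R).

Lemma chain_seriesM k : (k < N)%N ->
  (1 - mfX R (mpre k)) * chain_series k = chain_series k.+1.
Proof.
move=> ltkN; apply/mfpsP => m; rewrite mulrBl mul1r mfcoefB mfcoefXM /=.
rewrite chainS //; case: ifP => [le|].
  rewrite chainB //; case: (chain k m) => /=; last by rewrite subr0.
  by case: eqP => _; rewrite ?subr0 ?subrr.
(* When [mpre k] does not fit below [m], the slack at [k] is already minimal: otherwise position
   [k], and by monotonicity every earlier one, would be positive. *)
case: (boolP (chain k m)) => [ch /lep_mpre nle|_ _]; rewrite subr0 //=.
case: eqP => // ne; case: nle => i lti leik.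
apply: leq_trans (chain_mono ch leik).
by move/chainP: ch => /(_ k ltkN) []; lia.
Qed.

(** Once every slack is prescribed, the positions are determined backwards from the 0 at position
    [N]. *)
Lemma chain_full m : chain N m = (m == \sum_(j < N) mpre j *+ d j)%MM.
Proof.
have vE (i : 'I_N) :
    (\sum_(j < N) mpre j *+ d j)%MM (q i) = (\sum_(i <= j < N) d j)%N.
  rewrite mnm_sumE [RHS]big_geq_mkord big_mkcond [RHS]big_mkcond /=.
  by apply: eq_bigr => j _; rewrite mulmnE mpreE; case: leqP; rewrite ?mul1n.
apply/chainP/eqP => [H | -> i lti]; last first.
  have vN k : mpos (\sum_(j < N) mpre j *+ d j)%MM k = (\sum_(k <= j < N) d j)%N.
    have [ltk|lek] := ltnP k N; last by rewrite mpos_default // big_geq.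
    by rewrite (mposE _ (Ordinal ltk)) vE.
  by rewrite !vN [X in (_ <= X)%N]big_ltn // [LHS]big_ltn // addnC.
have E k : (k <= N)%N -> mpos m (N - k) = (\sum_(N - k <= j < N) d j)%N.
  elim: k => [|k IHk] lek; first by rewrite subn0 mpos_default // big_geq.
  have lt : (N - k.+1 < N)%N by lia.
  rewrite [RHS]big_ltn // addnC; have -> : (N - k.+1).+1 = (N - k)%N by lia.
  rewrite -IHk; last exact: ltnW.
  by have [_ ->] := H _ lt => //; congr (mpos m _ + _)%N; lia.
apply/mnmP => j; have -> : j = q ((q^-1)%g j) by rewrite permKV.
set i := (_ j); rewrite vE -mposE.
have -> : nat_of_ord i = (N - (N - i))%N by rewrite subKn // ltnW.
by apply: E; lia.
Qed.

(** The product formula for the indicator series, cleared of denominators: each factor fixes one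
    more slack, until a single monomial is left. *)
Lemma chain_series_prod :
  chain_series 0 * \prod_(j < N) (1 - mfX R (mpre j)) =
  mfX R (\sum_(j < N) mpre j *+ d j)%MM.
Proof.
have E k : (k <= N)%N ->
    chain_series 0 * \prod_(0 <= j < k) (1 - mfX R (mpre j)) = chain_series k.
  elim: k => [|k IHk] lek; first by rewrite big_geq ?mulr1.
  by rewrite big_nat_recr //= mulrA IHk ?(ltnW lek) // mulrC chain_seriesM.
rewrite -(big_mkord xpredT (fun j => 1 - mfX R (mpre j))) E //.
by apply/mfpsP => m /=; rewrite chain_full.
Qed.

End Chains.

(** * Stable sorting permutations *)

Section Sorting.
Variables (n : nat) (f : 'I_n.+1 -> nat).

(** Breaking ties by index makes this a strict total order, so that the sorting permutation is
    unique. *)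
Definition before (a b : 'I_n.+1) : bool :=
  (f b < f a)%N || (f b == f a) && (a < b)%N.

Definition sorts (p : 'S_n.+1) : bool :=
  [forall i : 'I_n.+1, forall k : 'I_n.+1,
     (k == i.+1 :> nat) ==> before (p i) (p k)].

Lemma sortsP (p : 'S_n.+1) :
  reflect (forall i k : 'I_n.+1, k = i.+1 :> nat -> before (p i) (p k)) (sorts p).
Proof.
apply: (iffP forallP) => [H i k /eqP E | H i].
  by have /forallP/(_ k)/implyP/(_ E) := H i.
by apply/forallP => k; apply/implyP => /eqP; apply: H.
Qed.

Lemma sorts_sorted (p : 'S_n.+1) :
  sorts p -> sorted before (map p (enum 'I_n.+1)).
Proof.
move=> /sortsP H; apply/(sortedP ord0) => i; rewrite size_map size_enum_ord => lt.
have nthE j (lt_j : (j < n.+1)%N) :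
    nth ord0 (map p (enum 'I_n.+1)) j = p (Ordinal lt_j).
  by rewrite (nth_map ord0) ?size_enum_ord // (nth_ord_enum ord0 (Ordinal lt_j)).
by rewrite (nthE _ lt) (nthE _ (ltnW lt)); apply: H.
Qed.

Lemma before_trans : transitive before.
Proof. by move=> b a c; rewrite /before; lia. Qed.

Lemma before_irr : irreflexive before.
Proof. by move=> a; rewrite /before; lia. Qed.

Lemma sorts_inj (p p' : 'S_n.+1) : sorts p -> sorts p' -> p = p'.
Proof.
move=> /sorts_sorted sp /sorts_sorted sp'.
have E : map p (enum 'I_n.+1) = map p' (enum 'I_n.+1).
  apply: (irr_sorted_eq before_trans before_irr sp sp') => x.
  have mem_p (s : 'S_n.+1) : x \in map s (enum 'I_n.+1).
    by apply/mapP; exists ((s^-1)%g x); rewrite ?mem_enum ?permKV.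
  by rewrite !mem_p.
by apply/permP => i; move/eq_in_map: E; apply; rewrite mem_enum.
Qed.

Lemma sorts_exists : exists p, sorts p.
Proof.
(* Sorting uses the reflexive, hence total, version of [before]; strictness is recovered from
   [uniq_s]. *)
pose le (a b : 'I_n.+1) := (f b < f a)%N || (f b == f a) && (a <= b)%N.
have le_total : total le by move=> a b; rewrite /le; lia.
pose s := sort le (enum 'I_n.+1).
have size_s : size s = n.+1 by rewrite size_sort size_enum_ord.
have uniq_s : uniq s by rewrite sort_uniq enum_uniq.
have s_inj : injective (fun i : 'I_n.+1 => nth ord0 s i).
  by move=> i j /eqP; rewrite nth_uniq ?size_s // => /eqP/val_inj.
exists (perm s_inj); apply/sortsP => i k Ek; rewrite !permE Ek.
have ltk : (i.+1 < size s)%N by rewrite size_s -Ek.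
have /(sortedP ord0)/(_ i ltk) := sort_sorted le_total (enum 'I_n.+1).
have : nth ord0 s i != nth ord0 s i.+1 by rewrite nth_uniq ?(ltnW ltk) //; lia.
by rewrite -val_eqE -/s /le /before /=; lia.
Qed.

Lemma sorts_unique : exists p0, sorts =1 pred1 p0.
Proof.
have [p0 sp0] := sorts_exists; exists p0 => p /=.
by apply/idP/eqP => [/sorts_inj|->]; first exact.
Qed.

End Sorting.

(** * Inverses and the sum over [Irn] *)

Lemma opp_colorK r : involutive (@opp_color r).
Proof.
case=> c lt; apply: val_inj => /=; case: c lt => [|c] lt.
  by rewrite subn0 modnn subn0 modnn.
by rewrite (@modn_small (r - c.+1)) ?modn_small; lia.
Qed.

Lemma winvK r n : involutive (@winv r n).
Proof.
case=> p c; rewrite /winv /= invgK; congr (_, _).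
by apply/ffunP => k; rewrite !ffunE /= permK opp_colorK.
Qed.

(** The window of the inverse lists the values [p^-1 i] with colors [opp_color (c (p^-1 i))]. Larger
    colors come first in the order on pairs, so having no descent means listing the values by
    decreasing color, ties increasing. *)
Lemma winv_Irn r n (p : 'S_n.+1) (c : {ffun 'I_n.+1 -> 'I_r}) :
  (winv (p, c) \in Irn r n.+1) = sorts (fun v => opp_color (c v)) (p^-1)%g.
Proof.
rewrite inE -subset0; apply/subsetP/sortsP => [H i k Ek | H i].
  have := H i; rewrite !inE => Hi; apply: contraT => nb; apply: Hi.
  apply/existsP; exists k; rewrite Ek eqxx /=.
  rewrite /clt /= !ffunE.
  (* Distinct values rule out equality, so the failure of [before] yields a descent. *)
  have : (p^-1)%g i != (p^-1)%g k :> nat.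
    by rewrite (inj_eq val_inj) (inj_eq perm_inj) -val_eqE /= Ek; lia.
  move: nb; rewrite /before /= -!val_eqE /=.
  move: ((r - c _) %% r)%N ((r - c _) %% r)%N => a b.
  move: (nat_of_ord ((p^-1)%g i)) (nat_of_ord ((p^-1)%g k)) => u v; lia.
rewrite !inE => /existsP[k /andP[/eqP Ek]]; have := H i k Ek.
rewrite /before /clt /= !ffunE -!val_eqE /=.
move: ((r - c _) %% r)%N ((r - c _) %% r)%N => a b.
by move: (nat_of_ord ((p^-1)%g i)) (nat_of_ord ((p^-1)%g k)) => u v; lia.
Qed.

(** After reindexing by inverses the weight depends on the colors [c] alone, and each [c] admits
    exactly one permutation; the sum over all [c] then factors. *)
Lemma sum_Irn r n (R : comNzRingType) (y : 'I_n.+1 -> R) :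
  \sum_(x in Irn r n.+1) \prod_(j < n.+1) y j ^+ NNeg (winv x) j =
  \prod_(j < n.+1) qnum r (y j).
Proof.
rewrite /qnum bigA_distr_bigA /=.
rewrite (reindex_inj (inv_inj (@winvK r n.+1))) /=.
under eq_bigr => x _ do rewrite winvK /NNeg.
rewrite -(pair_big_dep xpredT
  (fun p c => winv (p, c) \in Irn r n.+1)
  (fun _ c => \prod_j y j ^+ (c : {ffun 'I_n.+1 -> 'I_r}) j)) /=.
rewrite (exchange_big_dep xpredT) //=; apply: eq_bigr => c _.
have [p0 sp0] := sorts_unique (fun v => opp_color (c v)).
rewrite (big_pred1 (p0^-1)%g) // => p /=.
by rewrite winv_Irn sp0 /= (canF_eq invgK).
Qed.

(** * Chains in the variables z_0, ..., z_n *)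

Lemma zvE n (j : 'I_n) : zv j = mfX int U_(lift ord0 j)%MM. Proof. by []. Qed.
Lemma z0E n : z0 n = mfX int U_(ord0)%MM. Proof. by []. Qed.

(* Position 0 holds the variable z_0 and position i > 0 holds z_{p(i)}. *)
Definition zperm n (p : 'S_n) : 'S_n.+1 := lift_perm ord0 ord0 p.

(** Position [j.+1] belongs to [p j], hence the shift; the 0 at position 0 lets the exponent of z_0
    equal that of z_{p(1)}. *)
Definition desn n (p : 'S_n.+1) (i : nat) : nat :=
  if i is j.+1 then inord j \in Des p else 0%N.

Lemma mfX_mpre0 n (p : 'S_n) : mfX int (mpre (zperm p) 0) = z0 n.
Proof.
rewrite z0E /mpre big_mkcond big_ord_recl /= big1 ?addm0; last by [].
by rewrite lift_perm_id.
Qed.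

Lemma mfX_mpreS n (p : 'S_n) (j : 'I_n) : mfX int (mpre (zperm p) j.+1) = zpre p j.
Proof.
rewrite /zpre z0E /mpre big_mkcond big_ord_recl /= mfXD lift_perm_id.
congr (_ * _); rewrite -big_mkcond mfX_sum; apply: eq_big => [i | i _].
  by [].
by rewrite lift_perm_lift zvE.
Qed.

Lemma mfX_des n (p : 'S_n.+1) :
  mfX int (\sum_(j < n.+2) mpre (zperm p) j *+ desn p j)%MM =
  \prod_(j in Des p) zpre p j.
Proof.
rewrite big_ord_recl /= mulm0n add0m mfX_sum [RHS]big_mkcond /=.
apply: eq_bigr => j _; rewrite mfXMn mfX_mpreS /= inord_val.
by case: (j \in Des p); rewrite ?expr1 ?expr0.
Qed.

Lemma prod_mfX_mpre n (p : 'S_n) :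
  \prod_(j < n.+1) (1 - mfX int (mpre (zperm p) j)) =
  (1 - z0 n) * \prod_(j < n) (1 - zpre p j).
Proof.
rewrite big_ord_recl mfX_mpre0; congr (_ * _).
by apply: eq_bigr => j _; rewrite lift0 mfX_mpreS.
Qed.

Lemma zpreX n (p : 'S_n) (j : 'I_n) r :
  zpre p j ^+ r = z0 n ^+ r * \prod_(i < n | (i <= j)%N) zv (p i) ^+ r.
Proof. by rewrite exprMn prodrXl. Qed.

Lemma subrX_qnum (R : comNzRingType) (y : R) r : 1 - y ^+ r = (1 - y) * qnum r y.
Proof. by rewrite -opprB subrX1 -mulNr opprB. Qed.

Lemma sum_Irn_quotient r n (p : 'S_n.+1) : (0 < r)%N ->
  \sum_(x in Irn r n.+1)
    ((\prod_(j in Des p) zpre p j) *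
     (\prod_(j < n.+1) zpre p j ^+ NNeg (winv x) j)) /
    ((1 - z0 n.+1) *
     \prod_(j < n.+1)
       (1 - z0 n.+1 ^+ r * \prod_(i < n.+1 | (i <= j)%N) zv (p i) ^+ r)) =
  chain_series int (zperm p) (desn p) 0.
Proof.
move=> r_gt0; have Uden := unit_den p r_gt0.
(* The descent monomial is replaced by the chain series times its own denominator; it remains to
   match the denominators through 1 - y^r = (1 - y) [r]_y. *)
rewrite -mulr_suml -mulr_sumr sum_Irn -mfX_des -chain_series_prod prod_mfX_mpre.
apply: (canLR (mulrK Uden)); rewrite -mulrA; congr (_ * _); rewrite -mulrA.
congr (_ * _); rewrite -big_split /=; apply: eq_bigr => j _.
by rewrite -zpreX subrX_qnum.
Qed.

(** A descent of [p] demands exactly the strict inequality that [before] imposes when the index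
    drops; the slack at position 0 makes the exponent of z_0 the largest. *)
Lemma chain_sorts n (p : 'S_n.+1) (m : 'X_{1..n.+2}) :
  chain (zperm p) (desn p) 0 m =
  [forall j, m (lift ord0 j) <= m ord0]%N &&
  sorts (fun v => m (lift ord0 v)) p.
Proof.
have pos0 : mpos (zperm p) m 0 = m ord0 by rewrite (mposE _ _ ord0) lift_perm_id.
have posS (j : 'I_n.+1) : mpos (zperm p) m j.+1 = m (lift ord0 (p j)).
  by rewrite -lift0 mposE lift_perm_lift.
apply/idP/andP => [ch | [/forallP le /sortsP so]].
  split.
    apply/forallP => j; rewrite -pos0 -[j](permKV p) -posS.
    exact: chain_mono ch _.
  apply/sortsP => i k Ek; move/chainP: ch => /(_ i.+1 (ltn_ord i)) [+ _].
  rewrite /= inord_val posS -Ek posS /before.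
  case: (ltngtP (p i) (p k)) => [||/val_inj/perm_inj E]; last by rewrite E in Ek; lia.
    by lia.
  move=> ltp; suff -> : i \in Des p by lia.
  by rewrite inE; apply/existsP; exists k; rewrite Ek eqxx.
apply/chainP => -[_|i lti]; first by rewrite addn0 pos0 (posS ord0).
split=> //; rewrite ltnS in lti; rewrite (posS (Ordinal lti)) /=.
have -> : inord i = Ordinal lti by apply: val_inj; rewrite /= inordK.
(* The last position is followed by the default 0 and is never a descent, so its slack is
   unrestricted. *)
have [lti1|] := ltnP i.+1 n.+1; last first.
  move=> lei; rewrite mpos_default //.
  suff -> : (Ordinal lti \in Des p) = false by [].
  apply/negbTE; rewrite inE; apply/existsP => -[k /andP[/eqP Ek _]].
  by have := ltn_ord k; rewrite Ek /= ltnNge lei.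
rewrite (posS (Ordinal lti1)).
have := so (Ordinal lti) (Ordinal lti1) erefl; rewrite /before inE.
case: existsP => [[k /andP[/eqP Ek]]|]; last by lia.
by have -> : k = Ordinal lti1 by [exact: val_inj]; lia.
Qed.

(** * Comparison of coefficients *)

Lemma sum_chain_series n (m : 'X_{1..n.+2}) :
  mfcoef (\sum_(p : 'S_n.+1) chain_series int (zperm p) (desn p) 0) m =
  [forall j, m (lift ord0 j) <= m ord0]%N%:R.
Proof.
rewrite mfcoef_sum /=; under eq_bigr => p _ do rewrite chain_sorts.
have [p0 sp0] := sorts_unique (fun v => m (lift ord0 v)).
rewrite (bigD1 p0) //= big1 => [|p ne]; first by rewrite sp0 /= eqxx andbT addr0.
by rewrite sp0 /= (negbTE ne) andbF.
Qed.

(** Expanding the product gives one monomial per function [f] into {0, ..., k}; its exponents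
    recover [f], so no monomial repeats. *)
Lemma mfcoef_qnum n k (m : 'X_{1..n.+1}) :
  mfcoef (\prod_(j < n) qnum k.+1 (zv j) * z0 n ^+ k) m =
  ((m ord0 == k) && [forall j : 'I_n, m (lift ord0 j) <= k]%N)%:R.
Proof.
rewrite /qnum bigA_distr_bigA mulr_suml mfcoef_sum.
pose E (f : {ffun 'I_n -> 'I_k.+1}) : 'X_{1..n.+1} :=
  (\sum_j U_(lift ord0 j) *+ f j + U_(ord0) *+ k)%MM.
have E0 f : E f ord0 = k.
  by rewrite mnmDE mnm_sumE big1 => [|j _]; rewrite mulmnE mnm1E ?mul1n.
have ES f j : E f (lift ord0 j) = f j.
  rewrite mnmDE mnm_sumE mulmnE mnm1E addn0 (bigD1 j) //= mulmnE mnm1E eqxx mul1n.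
  rewrite big1 ?addn0 // => i ne; rewrite mulmnE mnm1E.
  by rewrite (inj_eq lift_inj) (negbTE ne).
have XE (f : {ffun 'I_n -> 'I_k.+1}) : (\prod_i zv i ^+ f i) * z0 n ^+ k = mfX int (E f).
  by rewrite mfXD mfX_sum mfXMn; under [in RHS]eq_bigr do rewrite mfXMn.
rewrite (eq_bigr (fun f => (m == E f)%:R)) => [|f _]; last by rewrite XE.
case: andP => [[/eqP m0 /forallP le] | nle]; last first.
  apply: big1 => f _; case: eqP => // Em; case: nle; rewrite Em E0; split=> //.
  by apply/forallP => j; rewrite ES -ltnS.
pose f0 := [ffun j => inord (m (lift ord0 j))] : {ffun 'I_n -> 'I_k.+1}.
rewrite (bigD1 f0) //= big1 => [|f ne].
  suff -> : m = E f0 by rewrite eqxx addr0.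
  apply/mnmP => i; case: (unliftP ord0 i) => [j|] ->; last by rewrite E0.
  by rewrite ES ffunE inordK // ltnS.
case: eqP => // Em; case/eqP: ne; apply/ffunP => j; apply: val_inj.
by rewrite ffunE Em ES inord_val.
Qed.

Theorem theorem5p14 (r n : nat) (hr : (0 < r)%N) (hn : (0 < n)%N) :
  mfsums
    (fun k : nat => (\prod_(j < n) qnum k.+1 (zv j)) * z0 n ^+ k)
    (\sum_(p : 'S_n) \sum_(x in Irn r n)
       ((\prod_(j in Des p) zpre p j) *
        (\prod_(j < n) zpre p j ^+ NNeg (winv x) j)) /
       ((1 - z0 n) *
        \prod_(j < n)
          (1 - z0 n ^+ r * \prod_(i < n | (i <= j)%N) zv (p i) ^+ r))).
Proof.
(* Only the term [k = m ord0] has a nonzero coefficient at [m], so the partial sums are stable from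
   [(m ord0).+1] on. *)
case: n hn => // n _ m; exists (m ord0).+1 => K lt_mK.
under [in RHS]eq_bigr => p _ do rewrite sum_Irn_quotient //.
rewrite sum_chain_series mfcoef_sum; under eq_bigr => k _ do rewrite mfcoef_qnum.
rewrite (bigD1 (Ordinal lt_mK)) //= big1 => [|k ne]; first by rewrite eqxx addr0.
by rewrite eq_sym (_ : (k == m ord0 :> nat) = false) //; apply: negbTE.
Qed.
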